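(* Let $\varphi$ be a convex $\varphi$-function. Let $I$ and $J$ be two compact sets of $\mathbb R$, and let $F:I\times J\to\mathbb R$ be a measurable function such that $F(\cdot,t)\in L^\varphi(I)$ uniformly with respect to $t\in J$. Let $g:J\to[0,\infty)$ be integrable on $J$, with $\|g\|_1:=\int_J g(t)\,dt>0$. Then there exists $\lambda>0$ such that $$I^\varphi\left[\lambda\int_J g(t)\,|F(\cdot,t)|\,dt\right]\le\frac1{\|g\|_1}\int_J g(t)\,I^\varphi\big[\lambda\|g\|_1F(\cdot,t)\big]\,dt.$$
   Context: A $\varphi$-function is a continuous non-decreasing $\varphi:[0,\infty)\to[0,\infty)$ with $\varphi(0)=0$, $\varphi(u)>0$ for $u>0$, $\lim_{u\to\infty}\varphi(u)=+\infty$. For measurable $f$ on $I$, $I^\varphi[f]:=\int_I\varphi(|f(x)|)\,dx$; $L^\varphi(I)$ is the set of measurable $f$ on $I$ with $I^\varphi[\lambda f]<+\infty$ for some $\lambda>0$. ''$F(\cdot,t)\in L^\varphi(I)$ uniformly with respect to $t\in J$'' means that there exists $\lambda^\star>0$, independent of $t$, such that $I^\varphi[\lambda^\star F(\cdot,t)]<+\infty$ for every $t\in J$. *)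

(* Defs.v *)
From HB Require Import structures.
From mathcomp Require Import all_boot all_order all_algebra.
From mathcomp Require Import all_classical all_reals all_analysis.
From mathcomp Require Import measurable_realfun.

Set Implicit Arguments.
Unset Strict Implicit.
Unset Printing Implicit Defensive.
Import Order.TTheory GRing.Theory Num.Theory.
Import numFieldNormedType.Exports.

Local Open Scope classical_set_scope.
Local Open Scope ring_scope.

(* Measurability is Lebesgue measurability, so integrals are taken against the
   completed measure [leb]; its domain [lebType R] is [R] with the
   Lebesgue-measurable sets (the library's [measurableTypeR R] only carries the
   Borel sets). *)
Notation leb := (@completed_lebesgue_measure _).
Notation lebType R := (caratheodory_type ((wlength (@idfun R))^*)%mu).

(* [R * R] with the completion of its product Borel sigma-algebra with respect
   to the two-dimensional Lebesgue measure. *)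
Notation leb2Type R := (g_sigma_algebraType
  (completed_algebra_gen (@lebesgue_measure R \x @lebesgue_measure R)%E)).

(* [phi : [0, +oo[ -> [0, +oo[] is represented by a function on [R] whose values
   on the negative reals are irrelevant. *)
Definition phi_function (R : realType) (phi : R -> R) : Prop :=
  [/\ {within `[0, +oo[%classic, continuous phi},
      {in `[0, +oo[ &, {homo phi : u v / u <= v}},
      phi 0 = 0,
      (forall u : R, 0 < u -> 0 < phi u) &
      phi u @[u --> +oo] --> +oo].

Definition convex_phi_function (R : realType) (phi : R -> R) : Prop :=
  phi_function phi /\ convex_function (`[0, +oo[%classic : set R) phi.

(* The integral of [g t * |F (x, t)|] over [J] may be infinite for some [x], so the
   modular is defined on extended-real functions, with [phi (+oo) = +oo]. *)
Definition phi_ext (R : realType) (phi : R -> R) (y : \bar R) : \bar R :=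
  if y is r%:E then (phi r)%:E else +oo%E.

Definition modular (R : realType) (phi : R -> R) (I : set R) (f : R -> \bar R)
  : \bar R :=
  (\int[leb]_(x in I) phi_ext phi `|f x|)%E.

Definition L_phi (R : realType) (phi : R -> R) (I : set R) : set (R -> R) :=
  [set f : R -> R | measurable_fun (I : set (lebType R)) f /\
    exists2 lambda : R, 0 < lambda &
      (modular phi I (fun x => (lambda * f x)%:E) < +oo)%E].

Definition uniformly_in_L_phi (R : realType) (phi : R -> R) (I J : set R)
    (F : R * R -> R) : Prop :=
  (forall t, J t -> L_phi phi I (fun x => F (x, t))) /\
  exists2 lambda : R, 0 < lambda &
    forall t, J t -> (modular phi I (fun x => (lambda * F (x, t))%:E) < +oo)%E.

(* The L1 norm of a function that is nonnegative on [J]. *)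
Definition norm1 (R : realType) (J : set R) (g : R -> R) : R :=
  \int[leb]_(t in J) g t.

(* Main.v *)
Require Import Defs.
From HB Require Import structures.
From mathcomp Require Import all_boot all_order all_algebra.
From mathcomp Require Import all_classical all_reals all_analysis.
From mathcomp Require Import ring lra measurable_realfun.

Import Order.TTheory GRing.Theory Num.Theory.
Import numFieldNormedType.Exports.

Local Open Scope classical_set_scope.
Local Open Scope ring_scope.

(** The inequality holds for every [lambda > 0], and the proof takes
    [lambda = 1].  Write [m] for the L1 norm of [g].  Since [g / m] is a
    probability density on [J], Jensen's inequality applied to
    [t |-> m * |F (x, t)|] gives, for fixed [x],
      phi (\int_J g t |F (x, t)| dt)
        <= 1/m * \int_J g t * phi (m |F (x, t)|) dt,
    and integrating in [x] and exchanging the two integrals of a nonnegative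
    function by Tonelli's theorem gives the claim.

    Jensen's inequality ([jensen_phi_ext]) comes from the supporting lines of
    [phi] ([convex_phi_supporting_line]).  When the inner integral is infinite,
    any supporting line of positive slope forces the right-hand side to be
    infinite as well.

    The delicate point is measurability: [F] is only measurable for the
    completed plane measure, so that a section [F (x, _)] may fail to be
    measurable for [x] in a null set, while Tonelli's theorem is about product
    sigma-algebras.  Off a plane null set [B], however, [F] is Borel
    ([completion_measurable_fun_off_null]).  Let [f'] be [F] with the value [0]
    on [B] and outside [I `*` J].  Then [f'] is Borel on the whole plane and
    [|f'| <= |F|].  On the left-hand side [F] may be replaced by [f'] because
    almost every section of [B] is null ([xsection_null]); on the right-hand
    side [|f'| <= |F|] is enough.  Jensen and Tonelli are applied to [f'].
    The comparisons at both ends involve functions of [x] or [t] whose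
    measurability is unknown, which is why [integral_le_off_null] does not
    assume any. *)

(** * Comparison of integrals without measurability *)

Section nonneg_integral.
Import HBNNSimple.

(** The integral of a nonnegative function is the supremum of the integrals of
    the simple functions below it, whether or not it is measurable.  A simple
    function below [f] keeps its integral when it is set to [0] on the null set
    [N], and is then below [g]. *)
Lemma integral_le_off_null {d} {T : measurableType d} {R : realType}
    (mu : {measure set T -> \bar R}) (D N : set T) (f g : T -> \bar R) :
  measurable N -> mu N = 0%E ->
  (forall x, D x -> (0 <= f x)%E) -> (forall x, D x -> (0 <= g x)%E) ->
  (forall x, D x -> ~ N x -> (f x <= g x)%E) ->
  (\int[mu]_(x in D) f x <= \int[mu]_(x in D) g x)%E.
Proof.
move=> mN N0 f0 g0 fg; rewrite (integral_mkcond D f) (integral_mkcond D g).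
rewrite ge0_integralTE; last by move=> x; rewrite erestrict_ge0.
rewrite ge0_integralTE; last by move=> x; rewrite erestrict_ge0.
apply: ge_ereal_sup => _ [h /= hf <-].
pose h' := proj_nnsfun h (measurableC mN).
have h'E x : h' x = if x \in N then 0 else h x.
  by rewrite /h' /= mindicE in_setC; case: (x \in N); rewrite /= ?mulr0 ?mulr1.
have -> : sintegral mu h = sintegral mu h'.
  rewrite -!integralT_nnsfun; apply: ge0_ae_eq_integral => //.
  - exact/measurable_EFinP.
  - exact/measurable_EFinP.
  - by move=> x _; rewrite lee_fin.
  - by move=> x _; rewrite lee_fin.
  exists N; split => // x hx; apply: contrapT => Nx; apply: hx => _.
  congr (_%:E); apply/esym; apply: etrans (h'E x) _.
  by rewrite memNset.
apply: ereal_sup_ubound; exists h' => //= x.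
rewrite -[X in X%:E]/(h' x) h'E.
have [xN|xN] := boolP (x \in N); first by rewrite erestrict_ge0.
apply: (le_trans (hf x)); rewrite !patchE.
case: ifPn => // /set_mem Dx; apply: fg => // Nx.
by move: xN; rewrite mem_set.
Qed.

End nonneg_integral.

(** * Completed measures and null sets *)

(** The sets that become measurable after removing a measurable null set form a
    sigma-algebra, and it contains the generators of the completion. *)
Lemma completion_measurable_off_null {d} {T : measurableType d} {R : realType}
    (mu : {measure set T -> \bar R}) (A : set T) :
  (completed_algebra_gen mu).-sigma.-measurable A ->
  exists B, [/\ measurable B, mu B = 0%E & measurable (A `\` B)].
Proof.
pose good (X : set T) :=
  exists B, [/\ measurable B, mu B = 0%E & measurable (X `\` B)].
apply: (smallest_sub (X := good)).
  split.
  - by exists set0; rewrite setD0; split.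
  - move=> X [B [mB B0 mXB]]; exists B; split => //.
    rewrite setTD.
    rewrite (_ : ~` X `\` B = ~` (X `\` B) `\` B).
      exact: measurableD (measurableC _) _.
    apply/seteqP; split => x /=; tauto.
  - move=> X /choice[B hB]; exists (\bigcup_k B k); split.
    + by apply: bigcupT_measurable => k; have [] := hB k.
    + apply/negligibleP.
        by apply: bigcupT_measurable => k; have [] := hB k.
      apply: negligible_bigcup => k; have [mB B0 _] := hB k.
      exact/negligibleP.
    + rewrite (_ : _ `\` _ = \bigcup_k (X k `\` B k) `\` \bigcup_k B k).
        apply: measurableD; apply: bigcupT_measurable => k; by have [] := hB k.
      apply/seteqP; split => x [[k _ Xk] nB]; split => //; exists k => //.
        by split => // Bk; apply: nB; exists k.
      by case: Xk.
move=> _ [X mX [N [M [mM M0 NM]]] <-]; exists M; split => //.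
rewrite (_ : _ `\` _ = X `\` M); first exact: measurableD.
apply/seteqP; split => x /=; have := NM x; tauto.
Qed.

(** The superlevel sets at rational heights determine all the others, and they
    are countably many, so that the union of their exceptional sets is null. *)
Lemma completion_measurable_fun_off_null {d} {T : measurableType d}
    {R : realType} (mu : {measure set T -> \bar R}) (D : set T) (f : T -> R) :
  measurable D ->
  measurable_fun (D : set (g_sigma_algebraType (completed_algebra_gen mu))) f ->
  exists B, [/\ measurable B, mu B = 0%E & measurable_fun (D `\` B) f].
Proof.
move=> mD mf.
have mD' : (completed_algebra_gen mu).-sigma.-measurable D.
  apply: sub_sigma_algebra; exists D => //; exists set0.
    exact: negligible_set0.
  by rewrite setU0.
(* [r] enumerates the rationals, with repetitions of [0]. *)
pose r (n : nat) : R := ratr (odflt 0%Q (unpickle n)).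
have /choice[B hB] (n : nat) : exists B, [/\ measurable B, mu B = 0%E &
    measurable ((D `&` f @^-1` `]r n, +oo[%classic) `\` B)].
  apply: completion_measurable_off_null.
  by apply: mf => //; exact: measurable_itv.
have mUB : measurable (\bigcup_n B n).
  by apply: bigcupT_measurable => n; have [] := hB n.
exists (\bigcup_n B n); split => //.
  apply/negligibleP => //; apply: negligible_bigcup => n.
  by have [mB B0 _] := hB n; exact/negligibleP.
move=> mDB; apply: (measurability _ (RGenOInfty.measurableE R)) => //.
move=> _ [_ [a ->] <-].
rewrite (_ : _ `&` _ = \bigcup_(n in [set n | a < r n])
  ((D `&` f @^-1` `]r n, +oo[) `\` B n) `\` \bigcup_n B n).
  apply: measurableD => //; apply: bigcup_measurable => n _.
  by have [] := hB n.
apply/seteqP; split => x /=.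
  move=> [[Dx nB]]; rewrite in_itv/= andbT => /rat_in_itvoo[q].
  rewrite in_itv/= => /andP[aq qf]; split => //.
  have rq : r (pickle q) = ratr q by rewrite /r pickleK.
  exists (pickle q); rewrite /= rq//.
  split; first by split => //=; rewrite in_itv/= qf.
  by move=> Bx; apply: nB; exists (pickle q).
move=> [[n /= an [[Dx]]]]; rewrite /= !in_itv/= !andbT => nf _ nB.
by split; [split|exact: lt_trans nf].
Qed.

(** By definition of the product measure, the measures of the sections of [B]
    integrate to [0], so almost all of them vanish. *)
Lemma xsection_null {d1 d2} {T1 : measurableType d1} {T2 : measurableType d2}
    {R : realType} (m1 : {measure set T1 -> \bar R})
    (m2 : {sigma_finite_measure set T2 -> \bar R}) (B : set (T1 * T2)) :
  measurable B -> (m1 \x m2)%E B = 0%E ->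
  exists N, [/\ measurable N, m1 N = 0%E &
    forall x, ~ N x -> m2 (xsection B x) = 0%E].
Proof.
move=> mB B0; have mS := measurable_fun_xsection m2 mB.
have /(ae_eq_integral_abs m1 measurableT mS)[N [mN N0 sub]] :
    (\int[m1]_x `|(m2 \o xsection B) x| = 0)%E.
  by rewrite -[RHS]B0; apply: eq_integral => x _; rewrite gee0_abs.
exists N; split => // x Nx; apply: contrapT => hx; apply/Nx/sub.
by move=> /(_ I).
Qed.

Lemma lebesgue_measurable_borel {R : realType} (A : set R) :
  measurable A -> measurable (A : set (lebType R)).
Proof. exact: sub_caratheodory. Qed.

(** Tonelli's theorem is applied to the product of two Lebesgue sigma-algebras,
    which lets the weight [g] be Lebesgue measurable; Borel functions of two
    variables have to be seen as measurable for it. *)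
Lemma measurable_fun_borel_leb2 {R : realType} (f : R * R -> R) :
  measurable_fun setT f ->
  measurable_fun [set: lebType R * lebType R] (f : lebType R * lebType R -> R).
Proof.
move=> mf.
have midR : measurable_fun [set: lebType R] (id : lebType R -> R).
  by move=> _ A mA; rewrite setTI; exact: lebesgue_measurable_borel.
have mid : measurable_fun [set: lebType R * lebType R]
    (id : lebType R * lebType R -> R * R).
  apply/measurable_fun_pairP; split.
    exact: (measurableT_comp midR measurable_fst).
  exact: (measurableT_comp midR measurable_snd).
exact: (measurableT_comp mf mid).
Qed.

(** * Convex phi-functions *)

Lemma phi_function_ge0 {R : realType} {phi : R -> R} (s : R) :
  phi_function phi -> 0 <= s -> 0 <= phi s.
Proof.
move=> [_ _ phi0 phi_gt0 _].
by rewrite le_eqVlt => /predU1P[<-|/phi_gt0/ltW//]; rewrite phi0.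
Qed.

Lemma measurable_phi_comp {d} {T : measurableType d} {R : realType}
    {phi : R -> R} (D : set T) (u : T -> R) :
  phi_function phi -> measurable_fun D u -> (forall t, D t -> 0 <= u t) ->
  measurable_fun D (phi \o u).
Proof.
move=> [cphi _ _ _ _] mu u0.
have mphi : measurable_fun (`[0, +oo[%classic : set R) phi.
  exact: subspace_continuous_measurable_fun.
apply: (measurable_comp _ _ mphi mu) => //.
by move=> _ [t Dt <-]/=; rewrite in_itv/= andbT u0.
Qed.

Lemma phi_ext_ge0 {R : realType} {phi : R -> R} (a : \bar R) :
  phi_function phi -> (0 <= a)%E -> (0 <= phi_ext phi a)%E.
Proof.
move=> hphi; case: a => //= r; rewrite !lee_fin.
exact: phi_function_ge0.
Qed.

Lemma le_phi_ext {R : realType} {phi : R -> R} (a b : \bar R) :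
  phi_function phi -> (0 <= a)%E -> (a <= b)%E ->
  (phi_ext phi a <= phi_ext phi b)%E.
Proof.
move=> [_ phi_nd _ _ _]; case: a b => [r| |] [s| |]//=;
  rewrite ?leey// !lee_fin.
move=> r0 rs; apply: phi_nd => //; rewrite in_itv/= andbT//.
exact: le_trans rs.
Qed.

(** Convexity at the point [v] of the segment from [s] to [t], cleared of its
    denominator: the weight of [s] is [(t - v) / (t - s)]. *)
Lemma convex_three_points {R : realType} {phi : R -> R} (s v t : R) :
  convex_function (`[0, +oo[%classic : set R) phi -> 0 <= s -> s < v -> v < t ->
  phi v * (t - s) <= (t - v) * phi s + (v - s) * phi t.
Proof.
move=> cphi s0 sv vt.
have st : s < t by exact: lt_trans vt.
have ts0 : 0 < t - s by rewrite subr_gt0.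
have p0 : 0 <= (t - v) / (t - s) by rewrite divr_ge0 ?subr_ge0 ?ltW.
have p1 : (t - v) / (t - s) <= 1.
  by rewrite ler_pdivrMr// mul1r lerD2l lerN2 ltW.
have sD : s \in `[0, +oo[%classic by rewrite inE/= in_itv/= s0.
have tD : t \in `[0, +oo[%classic.
  by rewrite inE/= in_itv/= andbT; apply: (le_trans s0); rewrite ltW//; lra.
pose p := (t - v) / (t - s).
have : phi (p * s + (1 - p) * t) <= p * phi s + (1 - p) * phi t.
  exact: cphi (Itv01 p0 p1) s t sD tD.
have -> : p * s + (1 - p) * t = v by rewrite /p; field; rewrite gt_eqF.
rewrite -(ler_pM2r ts0) => /le_trans; apply.
rewrite le_eqVlt; apply/orP; left; apply/eqP.
by rewrite /p; field; rewrite gt_eqF.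
Qed.

(** The slope of the supporting line at [v > 0] is the left derivative there,
    the supremum of the slopes of the chords that end at [v]: these are all at
    most the slopes of the chords that start at [v].  It is nonnegative because
    the chord from the origin has nonnegative slope.  At [v = 0] there is no
    chord on the left, but the horizontal line supports [phi] since
    [phi >= phi 0 = 0]. *)
Lemma convex_phi_supporting_line {R : realType} {phi : R -> R} (v : R) :
  convex_phi_function phi -> 0 <= v ->
  exists2 a, 0 <= a & forall s, 0 <= s -> phi v + a * s <= phi s + a * v.
Proof.
move=> hphi; have [_ _ phi0 _ _] := hphi.1.
have phi_ge0 s : 0 <= s -> 0 <= phi s by exact: phi_function_ge0 hphi.1.
rewrite le_eqVlt => /predU1P[<-|v0].
  by exists 0 => // s s0; rewrite phi0 !mul0r !addr0 phi_ge0.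
pose S := [set (phi v - phi s) / (v - s) | s in [set s | 0 <= s < v]].
have S0 : S ((phi v - phi 0) / (v - 0)) by exists 0 => //=; rewrite lexx.
have S_le t : v < t -> ubound S ((phi t - phi v) / (t - v)).
  move=> vt _ [s /= /andP[s0 sv] <-].
  rewrite ler_pdivrMr ?subr_gt0// mulrAC ler_pdivlMr ?subr_gt0//.
  have := convex_three_points s v t hphi.2 s0 sv vt; nra.
have supS : has_sup S.
  split; first by exists ((phi v - phi 0) / (v - 0)).
  by exists ((phi (v + 1) - phi v) / (v + 1 - v)); apply: S_le; rewrite ltrDl.
exists (sup S).
  apply: (@le_trans _ _ ((phi v - phi 0) / (v - 0))).
    by rewrite phi0 !subr0 divr_ge0 ?phi_ge0 ?ltW.
  exact: sup_upper_bound.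
move=> s s0; have [sv|vs|->//] := ltgtP s v.
  have /(sup_upper_bound supS) : S ((phi v - phi s) / (v - s)).
    by exists s => //=; rewrite s0.
  rewrite ler_pdivrMr ?subr_gt0//; nra.
have := sup_le_ub (proj1 supS) (S_le _ vs).
by rewrite ler_pdivlMr ?subr_gt0//; nra.
Qed.

(** Jensen's inequality for the probability density [g / m] and the function
    [m * u], whose mean is the argument of [phi_ext] and may be infinite. *)
Lemma jensen_phi_ext {d} {T : measurableType d} {R : realType}
    (mu : {measure set T -> \bar R}) (D : set T) (phi : R -> R) (g u : T -> R)
    (m : R) :
  convex_phi_function phi -> measurable D ->
  measurable_fun D g -> (forall t, D t -> 0 <= g t) ->
  measurable_fun D u -> (forall t, D t -> 0 <= u t) ->
  0 < m -> (\int[mu]_(t in D) (g t)%:E = m%:E)%E ->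
  (phi_ext phi (\int[mu]_(t in D) (g t * u t)%:E) <=
   (1 / m)%:E * \int[mu]_(t in D) (g t * phi (m * u t))%:E)%E.
Proof.
move=> hphi mD mg g0 mu_ u0 m0 gm.
have phi_ge0 s : 0 <= s -> 0 <= phi s by exact: phi_function_ge0 hphi.1.
have mu0 t : D t -> 0 <= m * u t by move=> Dt; rewrite mulr_ge0 ?u0// ltW.
have mphi : measurable_fun D (fun t => phi (m * u t)).
  apply: (measurable_phi_comp D (fun t => m * u t) hphi.1) => //.
  exact: measurable_funM.
have mgE : measurable_fun D (EFin \o g) by exact/measurable_EFinP.
have mgu : measurable_fun D (fun t => (g t * u t)%:E).
  by apply/measurable_EFinP; exact: measurable_funM.
have mgphi : measurable_fun D (fun t => (g t * phi (m * u t))%:E).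
  by apply/measurable_EFinP; exact: measurable_funM.
have gu0 t : D t -> (0 <= (g t * u t)%:E)%E.
  by move=> Dt; rewrite lee_fin mulr_ge0 ?g0 ?u0.
have gphi0 t : D t -> (0 <= (g t * phi (m * u t))%:E)%E.
  by move=> Dt; rewrite lee_fin mulr_ge0 ?g0 ?phi_ge0 ?mu0.
set A := (X in phi_ext _ X); set B := (X in ((1 / m)%:E * X)%E).
have A0 : (0 <= A)%E by exact: integral_ge0.
(* The supporting line at [v], evaluated at [m * u t], multiplied by [g t] and
   integrated; all terms are kept nonnegative by moving [a * v] to the right. *)
have line v a : 0 <= v -> 0 <= a ->
    (forall s, 0 <= s -> phi v + a * s <= phi s + a * v) ->
    ((phi v * m)%:E + (a * m)%:E * A <= B + (a * v * m)%:E)%E.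
  move=> v0 a0 hv.
  have cg c : 0 <= c -> ((c * m)%:E = \int[mu]_(t in D) (c * g t)%:E)%E.
    by move=> c0; rewrite EFinM -gm -ge0_integralZl_EFin//.
  have mcg c : measurable_fun D (fun t => (c * g t)%:E).
    by apply/measurable_EFinP; exact: measurable_funM.
  have cg0 c t : 0 <= c -> D t -> (0 <= (c * g t)%:E)%E.
    by move=> c0 Dt; rewrite lee_fin mulr_ge0 ?g0.
  have am0 : 0 <= a * m by rewrite mulr_ge0// ltW.
  have mamgu : measurable_fun D (fun t => (a * m)%:E * (g t * u t)%:E)%E.
    by apply: emeasurable_funM => //; exact: measurable_cst.
  have amgu0 t : D t -> (0 <= (a * m)%:E * (g t * u t)%:E)%E.
    by move=> Dt; apply: mule_ge0; [rewrite lee_fin|exact: gu0].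
  rewrite (cg (phi v))// ?(cg (a * v)) ?mulr_ge0// ?phi_ge0//.
  rewrite -ge0_integralZl_EFin//.
  rewrite -!ge0_integralD//; last 2 first.
  - by move=> t Dt; rewrite cg0 ?mulr_ge0.
  - by move=> t Dt; rewrite cg0 ?phi_ge0.
  apply: ge0_le_integral => //.
  - by move=> t Dt; rewrite adde_ge0 ?amgu0// cg0 ?phi_ge0.
  - exact: emeasurable_funD.
  - exact: emeasurable_funD.
  move=> t Dt; rewrite -EFinM -!EFinD lee_fin.
  have := ler_wpM2l (g0 _ Dt) (hv _ (mu0 _ Dt)).
  by congr (_ <= _); ring.
have [->|BNy] := eqVneq B +oo%E.
  by rewrite gt0_muley ?leey// lte_fin divr_gt0.
have Bfin : B \is a fin_num.
  by rewrite ge0_fin_numE ?integral_ge0// lt_neqAle BNy leey.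
case: (A) A0 line => [r r0 line|_ line|//].
  (* [r] is the mean of [m * u] for [g / m], so the linear terms cancel. *)
  have [a a0 ha] := convex_phi_supporting_line r hphi r0.
  have := line r a r0 a0 ha.
  rewrite -(fineK Bfin) -!EFinM -!EFinD !lee_fin => h.
  by rewrite mul1r mulrC ler_pdivlMr//; lra.
(* The integral [A] is infinite: the line at [1] has positive slope, and would
   make [B] infinite too. *)
have [a a0 ha] := convex_phi_supporting_line 1 hphi ler01.
have agt0 : 0 < a.
  have [_ _ phi0 phi_gt0 _] := hphi.1.
  have := ha 0 (lexx _); rewrite phi0 mulr0 mulr1 addr0 add0r.
  by apply: lt_le_trans; exact: phi_gt0.
have := line 1 a ler01 a0 ha.
by rewrite gt0_muley ?lte_fin ?mulr_gt0// addey// -(fineK Bfin) -EFinD leye_eq.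
Qed.

(** * The modular inequality *)

Theorem proposition4p3 (R : realType) (phi : R -> R)
    (hphi : convex_phi_function phi)
    (I J : set R) (hI : compact I) (hJ : compact J)
    (F : R * R -> R)
    (hF : measurable_fun (I `*` J : set (leb2Type R)) F)
    (hFphi : uniformly_in_L_phi phi I J F)
    (g : R -> R) (hg0 : forall t, J t -> 0 <= g t)
    (hg : leb.-integrable (J : set (lebType R)) (fun t => (g t)%:E))
    (hg1 : 0 < norm1 J g) :
  exists2 lambda : R, 0 < lambda &
    (modular phi I
       (fun x => lambda%:E * \int[leb]_(t in J) (g t * `|F (x, t)|)%:E) <=
     (1 / norm1 J g)%:E *
     \int[leb]_(t in J)
       ((g t)%:E *
        modular phi I (fun x => (lambda * norm1 J g * F (x, t))%:E)))%E.
Proof.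
have mIB := compact_measurable hI; have mJB := compact_measurable hJ.
have mI := lebesgue_measurable_borel _ mIB.
have mJ := lebesgue_measurable_borel _ mJB.
have mIJ : measurable (I `*` J) by exact: measurableX.
have [B [mB B0 mF]] := completion_measurable_fun_off_null
  (@lebesgue_measure R \x @lebesgue_measure R)%E _ _ mIJ hF.
have [N [mN N0 secN]] := xsection_null _ _ _ mB B0.
have phi0 : phi 0 = 0 by case: hphi.1.
have phi_ge0 s : 0 <= s -> 0 <= phi s by exact: phi_function_ge0 hphi.1.
have phi_nd s t : 0 <= s -> s <= t -> phi s <= phi t.
  move=> s0 st; case: hphi.1 => _ + _ _ _; apply => //.
    by rewrite in_itv/= andbT.
  by rewrite in_itv/= andbT; exact: le_trans st.
set m := norm1 J g in hg1 *.
have gm : (\int[leb]_(t in J) (g t)%:E = m%:E)%E.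
  by rewrite fineK//; exact: integrable_fin_num.
pose f' : R * R -> R := F \_ ((I `*` J) `\` B).
have mf' : measurable_fun [set: lebType R * lebType R] f'.
  apply: measurable_fun_borel_leb2.
  have mE : measurable ((I `*` J) `\` B) by exact: measurableD.
  exact/(measurable_restrictT F mE).
have f'_le x t : `|f' (x, t)| <= `|F (x, t)|.
  by rewrite /f' patchE; case: ifPn => //; rewrite normr0.
have f'_eq x t : I x -> J t -> ~ B (x, t) -> f' (x, t) = F (x, t).
  by move=> Ix Jt nB; rewrite /f' patchE mem_set.
have f'_out x t : ~ (I x /\ J t) -> f' (x, t) = 0.
  move=> nIJ; rewrite /f' patchE memNset// => -[[/= Ix Jt] _].
  by apply: nIJ.
pose u x t := `|f' (x, t)|.
have mu0 x t : 0 <= m * u x t by apply: mulr_ge0; [exact: ltW|exact: normr_ge0].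
have mg : measurable_fun (J : set (lebType R)) g.
  by apply/measurable_EFinP; exact: measurable_int hg.
have mu x : measurable_fun [set: lebType R] (u x).
  apply: measurableT_comp; first exact: normr_measurable.
  apply: (measurableT_comp mf'); exact: pair1_measurable.
exists 1 => //; rewrite (mul1r m).
(* Extended by [0] outside [J], the integrand of the double integral lives on
   the whole plane, as Tonelli's theorem requires. *)
pose H x t := ((g \_ J) t * phi (m * u x t))%:E.
have gJ0 t : 0 <= (g \_ J) t.
  by rewrite patchE; case: ifPn => // /set_mem /hg0.
have H0 x t : (0 <= H x t)%E.
  by rewrite lee_fin mulr_ge0 ?phi_ge0.
have mH : measurable_fun [set: lebType R * lebType R] (fun z => H z.1 z.2).
  apply/measurable_EFinP; apply: measurable_funM.
    have mgJ : measurable_fun [set: lebType R] (g \_ J).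
      exact/(measurable_restrictT (g : lebType R -> R) mJ).
    exact: (measurableT_comp mgJ measurable_snd).
  apply: (measurable_phi_comp [set: lebType R * lebType R]
    (fun z => m * u z.1 z.2) hphi.1).
    apply: measurable_funM => //; apply: measurableT_comp => //.
    by rewrite (_ : (fun z => f' (z.1, z.2)) = f')//; apply/funext => -[].
  by move=> z _; exact: mu0.
have gu0 x t : J t -> (0 <= (g t * u x t)%:E)%E.
  by move=> Jt; rewrite lee_fin mulr_ge0 ?hg0// /u.
have Igu0 x : (0 <= \int[leb]_(t in J) (g t * u x t)%:E)%E.
  by apply: integral_ge0 => t; exact: gu0.
apply: (@le_trans _ _
    (\int[leb]_(x in I) phi_ext phi (\int[leb]_(t in J) (g t * u x t)%:E))%E).
  have gF0 x t : J t -> (0 <= (g t * `|F (x, t)|)%:E)%E.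
    by move=> Jt; rewrite lee_fin mulr_ge0 ?hg0.
  (* For [x] in [I] off [N], the sections of [F] and [f'] agree almost
     everywhere on [J]. *)
  rewrite /modular; apply: (integral_le_off_null leb _ N).
  - exact: lebesgue_measurable_borel.
  - exact: N0.
  - by move=> x _; exact: phi_ext_ge0 hphi.1 _.
  - by move=> x _; exact: phi_ext_ge0 hphi.1 (Igu0 x).
  move=> x Ix nN.
  have IgF0 : (0 <= \int[leb]_(t in J) (g t * `|F (x, t)|)%:E)%E.
    by apply: integral_ge0 => t; exact: gF0.
  rewrite mul1e gee0_abs//; apply: le_phi_ext hphi.1 IgF0 _.
  apply: (integral_le_off_null leb _ (xsection B x)).
  - by apply: lebesgue_measurable_borel; exact: measurable_xsection.
  - exact: secN.
  - by move=> t; exact: gF0.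
  - by move=> t; exact: gu0.
  move=> t Jt nB; rewrite /u f'_eq// => Bx.
  by apply: nB; rewrite /xsection/= inE.
have HE x : (\int[leb]_(t in J) (g t * phi (m * u x t))%:E =
             \int[leb]_t H x t)%E.
  rewrite integral_mkcond; apply: eq_integral => t _.
  by rewrite /H !patchE; case: ifPn => //; rewrite mul0r.
have HI x : ~ I x -> (\int[leb]_t H x t = 0)%E.
  move=> nI; apply: integral0_eq => t _.
  by rewrite /H /u f'_out ?normr0 ?mulr0 ?phi0 ?mulr0// => -[].
have IH0 x : (0 <= \int[leb]_t H x t)%E by apply: integral_ge0 => t _.
apply: (@le_trans _ _ (\int[leb]_(x in I) ((1 / m)%:E * \int[leb]_t H x t))%E).
  apply: (integral_le_off_null leb _ set0) => //.
  - by move=> x _; exact: phi_ext_ge0 hphi.1 (Igu0 x).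
  - by move=> x _; apply: mule_ge0 => //; rewrite lee_fin divr_ge0// ltW.
  move=> x _ _; rewrite -HE; apply: jensen_phi_ext => //.
    exact: measurable_funTS.
  by move=> t _; exact: normr_ge0.
(* After the exchange only [|f'| <= |F|] is needed. *)
have Hle t : (\int[leb]_x H x t <= ((fun t => (g t)%:E *
        modular phi I (fun x => (m * F (x, t))%:E)) \_ J) t)%E.
  rewrite patchE; case: ifPn => [/set_mem Jt|nJ]; last first.
    rewrite (_ : integral _ _ _ = 0%E)//; apply: integral0_eq => y _.
    by rewrite /H patchE (negbTE nJ) mul0r.
  have mFt : measurable_fun (I : set (lebType R)) (fun x => `|m * F (x, t)|).
    apply: measurableT_comp; first exact: normr_measurable.
    apply: measurable_funM; first exact: measurable_cst.
    by have [] := hFphi.1 t Jt.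
  have mphiF : measurable_fun (I : set (lebType R))
      (fun x => phi_ext phi `|(m * F (x, t))%:E|).
    apply/measurable_EFinP.
    apply: (measurable_phi_comp _ _ hphi.1 mFt) => y _.
    exact: normr_ge0.
  have phiF0 : forall x, I x -> (0 <= phi_ext phi `|(m * F (x, t))%:E|)%E.
    by move=> x _; exact: phi_ext_ge0 hphi.1 _.
  rewrite /modular -(ge0_integralZl_EFin _ mI phiF0 mphiF (hg0 _ Jt)).
  rewrite [leRHS]integral_mkcond.
  apply: (integral_le_off_null leb _ set0) => //.
  - move=> x _; apply: erestrict_ge0 => y _; apply: mule_ge0.
      by rewrite lee_fin hg0.
    exact: phi_ext_ge0 hphi.1 _.
  move=> x _ _; rewrite patchE; case: ifPn => [/set_mem Ix|/negP nI].
    rewrite /H patchE mem_set//= lee_fin; apply: ler_wpM2l; first exact: hg0.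
    apply: phi_nd => //; rewrite normrM (gtr0_norm hg1) ler_pM2l//.
    exact: f'_le.
  rewrite /H /u f'_out ?normr0 ?mulr0 ?phi0 ?mulr0// => -[Ix _].
  by apply: nI; rewrite inE.
have mIH : measurable_fun (I : set (lebType R)) (fun x => \int[leb]_t H x t)%E.
  apply: measurable_funTS.
  exact: (measurable_fun_fubini_tonelli_F (m2 := leb)
    (fun z : lebType R * lebType R => H z.1 z.2) mH (fun z => H0 z.1 z.2)).
have m1_ge0 : 0 <= 1 / m by rewrite divr_ge0// ltW.
rewrite (ge0_integralZl_EFin _ mI (fun x _ => IH0 x) mIH m1_ge0).
rewrite lee_wpmul2l//.
rewrite integral_mkcond [leRHS]integral_mkcond.
rewrite (_ : (fun x => \int[leb]_t H x t)%E \_ I =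
             (fun x => \int[leb]_t H x t)%E).
  have -> : (\int[leb]_x \int[leb]_t H x t = \int[leb]_t \int[leb]_x H x t)%E.
    exact: (fubini_tonelli (m1 := leb) (m2 := leb)
      (fun z : lebType R * lebType R => H z.1 z.2) mH (fun z => H0 z.1 z.2)).
  apply: (integral_le_off_null leb _ set0) => //.
  - by move=> t _; apply: integral_ge0.
  - by move=> t _; apply: le_trans (Hle t); apply: integral_ge0.
apply/funext => x; rewrite patchE; case: ifPn => // /negP nI.
by rewrite HI// => Ix; apply: nI; rewrite inE.
Qed.
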